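(* Let $S \subseteq \mathbb{Z}^+$ be a set with upper density $1$, i.e. $\limsup_{n \to \infty} \frac{|S \cap [1,n]|}{n} = 1$. Then $S$ is a ladder.
   Context: $\mathbb{Z}^+$ denotes the set of positive integers. A set $S \subseteq \mathbb{Z}^+$ is a ladder if every coloring of $\mathbb{Z}$ with finitely many colors contains arbitrarily long (finite) monochromatic arithmetic progressions whose common difference lies in $S$. *)

(* Defs.v *)
From mathcomp Require Import all_boot all_order all_algebra finmap.
From mathcomp Require Import all_classical all_reals all_analysis.
Set Implicit Arguments. Unset Strict Implicit. Unset Printing Implicit Defensive.
Import Order.TTheory GRing.Theory Num.Theory.
Local Open Scope classical_set_scope.
Local Open Scope ring_scope.

(* A set of positive integers is a [S : set nat] with [S `<=` positive]. *)
Definition positive : set nat := [set d | (0 < d)%N].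

(* The value at n = 0 is 0 (x / 0 = 0), which does not affect the limsup. *)
Definition upper_density (R : realType) (S : set nat) : \bar R :=
  limn_esup (fun n : nat =>
    (#|` fset_set (S `&` [set k | (1 <= k <= n)%N])|%:R / n%:R : R)%:E).

(* The progression a, a + d, ..., a + (l - 1) d of length l. *)
Definition monochromatic (C : Type) (c : int -> C) (a : int) (d l : nat) : Prop :=
  exists x : C, forall i : nat, (i < l)%N -> c (a + (i * d)%:Z) = x.

(* Meant for S `<=` positive: any S containing 0 satisfies it trivially. *)
Definition ladder (S : set nat) : Prop :=
  forall (r : nat) (c : int -> 'I_r) (l : nat),
    exists a : int, exists2 d : nat, S d & monochromatic c a d l.

(* Main.v *)
Require Import Defs.
From mathcomp Require Import all_boot all_order all_algebra.
From mathcomp Require Import all_classical all_reals all_analysis.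
From mathcomp Require Import finmap zify.

(** A set [S] of upper density 1 contains a dilate [{d, 2d, ..., Md}] of every
    initial segment, and by van der Waerden's theorem a dilate of a long enough
    initial segment already supplies the common differences one needs.

    For the dilate: choose [n] large such that [S] misses very few of
    [1, ..., n].  If every [d <= n / M] had a multiple [k d] with [1 <= k <= M]
    outside [S], then, as [k] and [k d] determine [d], about [n / M^2]
    integers up to [n] would be missing, which is too many
    ([dilate_avoiding], [upper_density1_frequently]).

    Given a coloring [c] of the integers, apply the finite van der Waerden
    theorem to [i |-> c (i d)]: it yields a monochromatic progression whose
    difference [e] is at most a bound [M] that does not depend on [c], hence
    not on [d].  So [M] can be fixed before [d] is chosen, and [e d], the
    difference of the corresponding progression for [c], is in [S].

    Van der Waerden's theorem itself is proved by color focusing: from the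
    theorem for length [l], one builds more and more progressions of length [l],
    of pairwise distinct colors, that would all be continued by the same
    point, until the colors run out and that point must continue one of
    them in its own color ([color_focusing]). *)

Local Open Scope classical_set_scope.
Local Open Scope ereal_scope.

(** * Van der Waerden's theorem *)

Section Combinatorics.
Local Set Implicit Arguments.
Local Unset Strict Implicit.
Local Open Scope nat_scope.

(** Only the start and the difference are bounded: the end of the progression
    is then bounded in terms of [l] and [N], and the application needs a bound
    on the difference alone. *)
Definition has_ap (C : Type) (l N : nat) (c : nat -> C) : Prop :=
  exists a d, [/\ a <= N, 0 < d <= N & forall i, i < l -> c (a + i * d) = c a].

(** [p] is the pair of start and difference.  The focus lies after the
    progression, so that refocusing needs no subtraction. *)
Definition focused (C : Type) (l f : nat) (c : nat -> C) (p : nat * nat) : Prop :=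
  [/\ p.1 + l * p.2 = f, 0 < p.2 & forall i, i < l -> c (p.1 + i * p.2) = c p.1].

Lemma focused_extend (C : Type) l f (c : nat -> C) p :
  focused l f c p -> c p.1 = c f -> forall i, i < l.+1 -> c (p.1 + i * p.2) = c p.1.
Proof.
move=> [fE _ mono] cf i; rewrite ltnS leq_eqVlt => /predU1P[->|/mono//].
by rewrite fE.
Qed.

(** Induction on the number [k] of focused progressions.  Color each [b] by the
    whole window of [c] on [b, ..., b + N - 1], where [N] is the bound for [k],
    and take a progression of equal windows of difference [D].
    The [k] progressions focused at [f] in the first window occur at the same
    places in each of them; taking the [i]-th term in the [i]-th window, that
    is, adding [D] to each difference, refocuses them all at the copy of [f] in
    the window that would come next.  The copies of [f] itself form
    one more progression with that focus.  Its color is new, for otherwise [f]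
    already continued one of the [k] progressions. *)
Lemma color_focusing (l : nat) :
  (forall C : finType, exists N, forall c : nat -> C, has_ap l N c) ->
  forall (C : finType) (k : nat), exists N, forall c : nat -> C,
    has_ap l.+1 N c \/
    exists f (s : seq (nat * nat)), [/\ f < N, size s = k, uniq [seq c p.1 | p <- s] &
      forall p, p \in s -> p.2 <= N /\ focused l f c p].
Proof.
move=> IHl C; elim=> [|k [N IHk]].
  by exists 1 => c; right; exists 0, [::].
have [M vdW_M] := IHl {ffun 'I_N -> C}.
exists (M + l * M + N) => c.
have [b [D [leb /andP[D0 leD] window]]] := vdW_M (fun b => [ffun i : 'I_N => c (b + i)]).
have {}window i x : i < l -> x < N -> c (b + i * D + x) = c (b + x).
  by move=> /window /ffunP eqw xN; have := eqw (Ordinal xN); rewrite !ffunE.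
have lDM : l * D <= l * M by rewrite leq_mul2l leD orbT.
case: (IHk (fun x => c (b + x))) => [[a [d [aN dN mono]]]|[f [s [fN szs us fs]]]].
  left; exists (b + a), d; split; [lia|lia|].
  by move=> i /mono; rewrite addnA.
have [/mapP[[x d] /fs[/= dN fp] /= cp]|cf] := boolP (c (b + f) \in [seq c (b + p.1) | p <- s]).
  have /= mono := focused_extend fp (esym cp).
  case: fp => /= fE d0 _.
  have xf : x <= f by rewrite -fE leq_addr.
  left; exists (b + x), d; split; [lia|lia|].
  by move=> i /mono; rewrite addnA.
right; exists (b + l * D + f), ((b + f, D) :: [seq (b + p.1, p.2 + D) | p <- s]); split.
- lia.
- by rewrite /= size_map szs.
- by rewrite /= -map_comp /comp /= cf.
move=> p; rewrite inE => /predU1P[->|/mapP[[x d] /fs[/= dN [/= fE d0 mono]] ->]] /=.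
  split; first lia.
  split=> [||i il] /=; [lia|lia|].
  by rewrite addnAC window.
split; first lia.
split=> [||i il] /=; [lia|lia|].
have id : i * d <= l * d by rewrite leq_mul2r (ltnW il) orbT.
rewrite -(mono i il) -(window i _ il); last lia.
congr c; lia.
Qed.

(** There is no room for [#|C| + 1] distinct colors, so focusing that many
    progressions of length [l] must produce one of length [l + 1]. *)
Theorem van_der_waerden (l : nat) (C : finType) :
  exists N, forall c : nat -> C, has_ap l N c.
Proof.
elim: l C => [C|l IHl C]; first by exists 1 => c; exists 0, 1.
have [N focus] := color_focusing IHl C #|C|.+1.
exists N => c; case: (focus c) => // -[f [s [_ szs us _]]].
have := max_card [in [seq c p.1 | p <- s]].
by rewrite (card_uniqP us) size_map szs ltnn.
Qed.

(** * Dilates of initial segments in dense sets *)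

(** Otherwise each [d <= n / M] has a multiplier [k d <= M] that sends it to a
    missing element [k d * d <= n], and [d |-> (k d * d, k d)] is an injection
    into the pairs of a missing element and a multiplier. *)
Lemma dilate_avoiding (P : pred nat) (M n : nat) :
  0 < M -> size [seq j <- iota 1 n | ~~ P j] * M < n %/ M ->
  exists2 d, 0 < d & forall k, 0 < k <= M -> P (k * d).
Proof.
move=> M0; apply: contraPP => /forall2NP bad.
apply/negP; rewrite -leqNgt.
have {}bad d : exists k, 0 < d -> 0 < k <= M /\ ~~ P (k * d).
  have [d0|/existsNP[k /not_implyP[kM /negP nP]]] := bad d; last by exists k.
  by exists 0 => /d0.
have [k kP] := choice bad.
set T := [seq j <- _ | _].
have /uniq_leq_size : uniq [seq (k d * d, k d) | d <- iota 1 (n %/ M)].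
  rewrite map_inj_in_uniq ?iota_uniq// => d e; rewrite !mem_iota => /andP[d0 _] _ [kde kE].
  have [/andP[k0 _] _] := kP _ d0.
  by apply/eqP; rewrite -(eqn_pmul2l k0) kde kE.
move=> /(_ [seq (j, i) | j <- T, i <- iota 1 M]).
rewrite size_map !size_iota size_allpairs size_iota; apply.
move=> _ /mapP[d + ->]; rewrite mem_iota add1n ltnS => /andP[d0 dn].
have [/andP[k0 kM] nP] := kP _ d0.
apply: allpairs_f; last by rewrite mem_iota k0 add1n ltnS.
rewrite mem_filter nP mem_iota muln_gt0 k0 d0 add1n ltnS /=.
by apply: leq_trans (leq_mul kM dn) _; rewrite mulnC leq_trunc_div.
Qed.

Lemma card_fset_set_interval (S : set nat) (n : nat) :
  size [seq j <- iota 1 n | j \notin S] +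
    #|` fset_set (S `&` [set k | (1 <= k <= n)%N]) | = n.
Proof.
have fS : finite_set (S `&` [set k | 1 <= k <= n]).
  apply: (@sub_finite_set _ _ `I_n.+1); last exact: finite_II.
  by move=> k [_ /andP[]].
suff /perm_size -> : perm_eq (enum_fset (fset_set (S `&` [set k | 1 <= k <= n])))
    [seq j <- iota 1 n | j \in S].
  by rewrite !size_filter addnC -[RHS](size_iota 1) -(count_predC (mem S)).
apply: uniq_perm; rewrite ?fset_uniq ?filter_uniq ?iota_uniq// => j.
rewrite mem_filter mem_iota add1n ltnS in_fset_set// in_setI; congr (_ && _).
by apply/idP/idP; rewrite in_setE.
Qed.

End Combinatorics.

Section UpperDensity.
Import Order.TTheory GRing.Theory Num.Theory.

(** If from some point on at least a fraction [1 / m] of [1, ..., n] were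
    missing, the upper density would be at most [1 - 1 / m]. *)
Lemma upper_density1_frequently (R : realType) (S : set nat) (m n0 : nat) :
  upper_density R S = 1 ->
  exists2 n, (n0 <= n)%N & (size [seq j <- iota 1 n | j \notin S] * m < n)%N.
Proof.
move=> hS.
case: m => [|m]; first by exists n0.+1; rewrite ?muln0.
apply: contrapT => /forall2NP none.
suff : upper_density R S <= (1 - m.+1%:R^-1)%:E.
  by rewrite hS lee_fin lerBrDr gerDl leNgt invr_gt0 ltr0n.
(* Indices at least n0.+1 rather than n0, so that n is nonzero below. *)
apply: (@le_trans _ _ _ _ _ (ereal_inf_lbound _)).
  by exists [set n | (n0.+1 <= n)%N]; first by exists n0.+1.
apply: ge_ereal_sup => _ [n /= n0n <-].
have [|/negP] := none n; first by case; exact: ltnW.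
rewrite -leqNgt => nT.
have nE := card_fset_set_interval S n.
have n_gt0 : (0 < n%:R :> R)%R by rewrite ltr0n; lia.
rewrite lee_fin ler_pdivrMr//.
set A := #|` _| in nE *.
set T := size _ in nE nT.
rewrite mulrBl mul1r lerBrDl -[in leRHS]nE natrD lerD2r.
by rewrite mulrC ler_pdivrMr ?ltr0n// -natrM ler_nat.
Qed.

End UpperDensity.

Theorem theorem2p10 (R : realType) (S : set nat) (hpos : S `<=` positive)
  (hS : upper_density R S = 1) : ladder S.
Proof.
move=> r c l.
have [N vdW] := van_der_waerden l 'I_r.
pose M := N.+1.
(* Writing t for the number of missing elements, t * M < n %/ M amounts to
   t * M ^ 2 + M <= n, and each of the two summands gets half of n. *)
have [n nM sparse] := upper_density1_frequently R S (2 * M * M) (2 * M) hS.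
have [|d d0 Sd] := @dilate_avoiding (fun j => j \in S) M n isT.
  rewrite leq_divRL//; nia.
have [a [e [aN /andP[e0 eN] mono]]] := vdW (fun i => c (Posz (i * d))).
exists (Posz (a * d)), (e * d)%N.
  by apply/set_mem/Sd; rewrite e0 ltnW.
exists (c (Posz (a * d))) => i /mono <-.
by rewrite mulnA -PoszD -mulnDl.
Qed.
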